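(* For every $\lambda>0$, $(\mathfrak g_4,S_3^\lambda,J)$ is not a second kind algebraic Ricci soliton associated to $\nabla^0$: there do not exist $c\in\mathbb R$ and a derivation $D$ of $\mathfrak g_4$ such that $\widetilde{\operatorname{Ric}}^0=c\operatorname{Id}+D$.
   Context: $\mathfrak g_4$ is the real Lie algebra with basis $e_1,e_2,e_3,e_4$ and non-zero brackets (up to skew-symmetry) $[e_1,e_2]=e_3$, $[e_1,e_3]=e_4$. For $\lambda>0$, $S_3^\lambda$ is the Lorentzian inner product $\langle\cdot,\cdot\rangle$ on $\mathfrak g_4$ whose matrix in $(e_1,e_2,e_3,e_4)$ is $\begin{bmatrix}0&0&1&0\\0&1&0&0\\1&0&0&0\\0&0&0&\lambda\end{bmatrix}$. Fix the basis $v_1=e_2$, $v_2=\frac1{\sqrt\lambda}e_4$, $v_3=\frac1{\sqrt2}(e_1+e_3)$, $v_4=\frac1{\sqrt2}(e_1-e_3)$, which is orthonormal: $\langle v_i,v_j\rangle=0$ for $i\ne j$, $\langle v_i,v_i\rangle=1$ for $i=1,2,3$, $\langle v_4,v_4\rangle=-1$. The product structure $J$ is the linear map with $Jv_i=v_i$ for $i=1,2,3$ and $Jv_4=-v_4$. Write $\mathfrak g$ for the Lie algebra. The Levi-Civita connection is the bilinear map $\nabla:\mathfrak g\times\mathfrak g\to\mathfrak g$ with $2\langle\nabla_uv,w\rangle=\langle[u,v],w\rangle+\langle[w,u],v\rangle+\langle[w,v],u\rangle$ for all $u,v,w$. Put $(\nabla_uJ)v=\nabla_u(Jv)-J(\nabla_uv)$.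 The canonical connection is $\nabla^0_uv=\nabla_uv-\frac12(\nabla_uJ)Jv$. Its curvature is $R^0_{uv}w=\nabla^0_{[u,v]}w-\nabla^0_u\nabla^0_vw+\nabla^0_v\nabla^0_uw$, its Ricci operator is $\operatorname{Ric}^0(u)=\sum_{k=1}^4\langle v_k,v_k\rangle R^0_{v_ku}v_k$, and $\rho^0(u,v)=\langle\operatorname{Ric}^0(u),v\rangle$. Put $\widetilde\rho^0(u,v)=\frac12(\rho^0(u,v)+\rho^0(v,u))$ and define $\widetilde{\operatorname{Ric}}^0$ by $\langle\widetilde{\operatorname{Ric}}^0(u),v\rangle=\widetilde\rho^0(u,v)$. A derivation of $\mathfrak g$ is a linear map $D:\mathfrak g\to\mathfrak g$ with $[D(u),v]+[u,D(v)]=D[u,v]$ for all $u,v\in\mathfrak g$. *)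

(* Defs.v *)
From HB Require Import structures.
From mathcomp Require Import all_boot all_order all_algebra.
From mathcomp Require Import reals.
From mathcomp Require Import ring.
Set Implicit Arguments.
Unset Strict Implicit.
Unset Printing Implicit Defensive.
Import Order.TTheory GRing.Theory Num.Theory.
Local Open Scope ring_scope.

(* A Lie algebra with a pseudo-Riemannian inner product and a product
   structure, in coordinates: vectors are row vectors, [br] is the bracket,
   [S] the Gram matrix of the inner product in the coordinate basis, [v] an
   orthonormal frame and [J] the product structure. *)
Section Connections.
Variables (R : realType) (n : nat).
Local Notation g := 'rV[R]_n.
Variables (br : g -> g -> g) (S : 'M[R]_n) (v : 'I_n -> g) (J : g -> g).

Definition inner (x y : g) : R := (x *m S *m y^T) 0 0.

(* The vector dual to the linear form [f]: see [inner_sharp] and [inner_inj]. *)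
Definition sharp (f : g -> R) : g := (\row_j f (delta_mx 0 j)) *m invmx S.

Definition levi_civita (x y : g) : g :=
  sharp (fun w => 2^-1 * (inner (br x y) w + inner (br w x) y
                          + inner (br w y) x)).

Definition nabla_J (x y : g) : g :=
  levi_civita x (J y) - J (levi_civita x y).

Definition canonical_connection (x y : g) : g :=
  levi_civita x y - 2^-1 *: nabla_J x (J y).

Definition curvature0 (x y w : g) : g :=
  canonical_connection (br x y) w
  - canonical_connection x (canonical_connection y w)
  + canonical_connection y (canonical_connection x w).

Definition Ric0 (x : g) : g :=
  \sum_(k < n) inner (v k) (v k) *: curvature0 (v k) x (v k).

Definition rho0 (x y : g) : R := inner (Ric0 x) y.

Definition sym_rho0 (x y : g) : R := 2^-1 * (rho0 x y + rho0 y x).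

Definition sym_Ric0 (x : g) : g := sharp (sym_rho0 x).

Definition derivation (D : g -> g) : Prop :=
  forall x y, br (D x) y + br x (D y) = D (br x y).

Definition second_kind_Ricci_soliton0 : Prop :=
  exists (c : R) (D : {linear g -> g}),
    derivation D /\ forall x, sym_Ric0 x = c *: x + D x.

Lemma inner_linearl y : scalar (inner^~ y).
Proof. by move=> a x z; rewrite /inner !mulmxDl -!scalemxAl !mxE. Qed.

Lemma inner_linearr x : scalar (inner x).
Proof.
by move=> a y z; rewrite /inner linearD linearZ /= mulmxDr -scalemxAr !mxE.
Qed.

Lemma innerDl x y z : inner (x + y) z = inner x z + inner y z.
Proof. by have := inner_linearl z 1 x y; rewrite scale1r mul1r. Qed.

Lemma innerDr x y z : inner z (x + y) = inner z x + inner z y.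
Proof. by have := inner_linearr z 1 x y; rewrite scale1r mul1r. Qed.

Lemma innerZl a x z : inner (a *: x) z = a * inner x z.
Proof. by rewrite /inner -!scalemxAl mxE. Qed.

Lemma innerZr a x z : inner z (a *: x) = a * inner z x.
Proof. by rewrite /inner linearZ /= -scalemxAr mxE. Qed.

Hypothesis S_unit : S \in unitmx.

Lemma inner_inj x y : (forall w, inner x w = inner y w) -> x = y.
Proof.
move=> xy; rewrite -[x](mulmxK S_unit) -[y](mulmxK S_unit); congr (_ *m _).
apply/rowP => j; have := xy (delta_mx 0 j).
by rewrite /inner trmx_delta -!colE !mxE.
Qed.

Lemma inner_sharp (f : g -> R) w : scalar f -> inner (sharp f) w = f w.
Proof.
move=> fL; rewrite /inner /sharp mulmxKV // mxE.
pose h : {scalar g} := HB.pack f (GRing.isLinear.Build _ _ _ _ f fL).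
rewrite [in RHS](row_sum_delta w) -[f]/(h : g -> R) linear_sum /=.
by apply: eq_bigr => j _; rewrite !mxE -[f]/(h : g -> R) linearZ /= mulrC.
Qed.

Lemma sharp_linear (F : g -> g -> R) :
  (forall w, scalar (F^~ w)) -> linear (fun x => sharp (F x)).
Proof.
move=> FL a x y; rewrite /sharp scalemxAl -mulmxDl; congr (_ *m _).
by apply/rowP => j; rewrite !mxE FL.
Qed.

Hypothesis br_linearl : forall y, linear (br^~ y).
Hypothesis br_linearr : forall x, linear (br x).

Lemma koszul x y w :
  2 * inner (levi_civita x y) w
  = inner (br x y) w + inner (br w x) y + inner (br w y) x.
Proof.
rewrite inner_sharp; first by field.
move=> a u t; rewrite !br_linearl !innerDl !innerZl innerDr innerZr.
ring.
Qed.

Lemma levi_civita_linearl y : linear (levi_civita^~ y).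
Proof.
apply: sharp_linear => w a x z.
rewrite br_linearl br_linearr !innerDl !innerZl innerDr innerZr; ring.
Qed.

Lemma levi_civita_linearr x : linear (levi_civita x).
Proof.
apply: sharp_linear => w a y z.
rewrite !br_linearr !innerDl !innerZl innerDr innerZr; ring.
Qed.

Hypothesis J_linear : linear J.

Let comb (a c : R) (p q r p' q' r' : g) :
  c *: (a *: p + p' - (a *: q + q') + (a *: r + r'))
  = a *: (c *: (p - q + r)) + c *: (p' - q' + r').
Proof. by apply/rowP => j; rewrite !mxE; ring. Qed.

Let comb2 (a : R) (p q r p' q' r' : g) :
  a *: p + p' - 2^-1 *: (a *: q + q' - (a *: r + r'))
  = a *: (p - 2^-1 *: (q - r)) + (p' - 2^-1 *: (q' - r')).
Proof. by apply/rowP => j; rewrite !mxE; ring. Qed.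

Lemma canonical_connection_linearl y : linear (canonical_connection^~ y).
Proof.
move=> a x z; rewrite /canonical_connection /nabla_J !levi_civita_linearl.
by rewrite J_linear comb2.
Qed.

Lemma canonical_connection_linearr x : linear (canonical_connection x).
Proof.
move=> a y z; rewrite /canonical_connection /nabla_J.
by do !rewrite ?levi_civita_linearr ?J_linear; rewrite comb2.
Qed.

Lemma Ric0_linear : linear Ric0.
Proof.
move=> a x y; rewrite /Ric0 scaler_sumr -big_split /=; apply: eq_bigr => k _.
rewrite /curvature0 br_linearr.
do !rewrite ?canonical_connection_linearl ?canonical_connection_linearr.
by rewrite comb.
Qed.

Lemma inner_sym_Ric0 x y : inner (sym_Ric0 x) y = sym_rho0 x y.
Proof.
rewrite /sym_Ric0 inner_sharp // /sym_rho0 /rho0.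
move: Ric0 Ric0_linear => f fL a u w.
rewrite fL !innerDl !innerZl innerDr innerZr; ring.
Qed.

End Connections.

(* The linear map sending [v k] to [eps k *: v k] for a basis [v]: see
   [diag_mapE]. *)
Definition diag_map (R : realType) (n : nat) (v : 'I_n -> 'rV[R]_n)
    (eps : 'I_n -> R) (x : 'rV[R]_n) : 'rV[R]_n :=
  x *m invmx (\matrix_k v k) *m diag_mx (\row_k eps k) *m (\matrix_k v k).

Lemma diag_map_linear (R : realType) (n : nat) (v : 'I_n -> 'rV[R]_n) eps :
  linear (diag_map v eps).
Proof. by move=> a x y; rewrite /diag_map !mulmxDl -!scalemxAl. Qed.

Lemma diag_mapE (R : realType) (n : nat) (v : 'I_n -> 'rV[R]_n) eps k :
  (\matrix_k v k) \in unitmx -> diag_map v eps (v k) = eps k *: v k.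
Proof.
move=> vU; rewrite /diag_map -{1}[v k](rowK v) -!row_mul mulmxV // mul1mx.
by apply/rowP => j; rewrite mul_diag_mx !mxE.
Qed.

Section G4.
Variable R : realType.
Local Notation g4 := 'rV[R]_4.

(* Coordinates are indexed from 0: [e k] is the basis vector e_{k+1}. *)
Local Notation e k := (delta_mx 0 (k : 'I_4) : g4).

Definition g4_bracket (x y : g4) : g4 :=
  (x 0 0 * y 0 1 - x 0 1 * y 0 0) *: e 2
  + (x 0 0 * y 0 2 - x 0 2 * y 0 0) *: e 3.

Definition S3 (lam : R) : 'M[R]_4 :=
  \matrix_(i, j) nth 0 (nth [::] [:: [:: 0; 0; 1; 0];
                                     [:: 0; 1; 0; 0];
                                     [:: 1; 0; 0; 0];
                                     [:: 0; 0; 0; lam]] i) j.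

Definition g4_frame (lam : R) (k : 'I_4) : g4 :=
  [:: e 1;
      (Num.sqrt lam)^-1 *: e 3;
      (Num.sqrt 2)^-1 *: (e 0 + e 2);
      (Num.sqrt 2)^-1 *: (e 0 - e 2)]`_k.

Definition g4_sign (k : 'I_4) : R := [:: 1; 1; 1; -1]`_k.

Definition g4_J (lam : R) : g4 -> g4 := diag_map (g4_frame lam) g4_sign.

Lemma g4_bracket_linearl y : linear (g4_bracket^~ y).
Proof.
by move=> a x z; apply/rowP => j; rewrite !mxE; ring.
Qed.

Lemma g4_bracket_alt x : g4_bracket x x = 0.
Proof. by apply/rowP => j; rewrite !mxE; ring. Qed.

Lemma g4_bracket_anti x y : g4_bracket x y = - g4_bracket y x.
Proof. by apply/rowP => j; rewrite !mxE; ring. Qed.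

Lemma g4_bracket_linearr x : linear (g4_bracket x).
Proof. by move=> a y z; apply/rowP => j; rewrite !mxE; ring. Qed.

Lemma g4_jacobi x y z :
  g4_bracket x (g4_bracket y z) + g4_bracket y (g4_bracket z x)
  + g4_bracket z (g4_bracket x y) = 0.
Proof. by apply/rowP => j; rewrite !mxE /=; ring. Qed.

Lemma g4_bracket_basis (i j : 'I_4) : (i < j)%N ->
  g4_bracket (e i) (e j) =
  if (i == 0) && (j == 1) then e 2
  else if (i == 0) && (j == 2) then e 3 else 0.
Proof.
move=> ij; rewrite /g4_bracket !mxE.
case: i ij => -[|[|[|[|//]]]] /= ?; case: j => -[|[|[|[|//]]]] //= ? _;
  by rewrite -?val_eqE /= ?mulr0 ?mulr1 ?mul0r ?subr0 ?scale0r ?scale1r ?addr0 ?add0r.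
Qed.

Lemma S3_unit lam : 0 < lam -> S3 lam \in unitmx.
Proof.
move=> l0; pose T := S3 lam^-1.
suff : S3 lam *m T = 1%:M by case/mulmx1_unit.
apply/matrixP => i j; rewrite !mxE !big_ord_recl big_ord0 !mxE /=.
by case: i => -[|[|[|[|//]]]] /= ?; case: j => -[|[|[|[|//]]]] /= ?;
  rewrite -?val_eqE /= ?mulr0 ?mul0r ?mulr1 ?divff ?gt_eqF ?addr0 ?add0r.
Qed.

Lemma inner_S3 lam x y : inner (S3 lam) x y =
  x 0 0 * y 0 2 + x 0 1 * y 0 1 + x 0 2 * y 0 0 + lam * x 0 3 * y 0 3.
Proof.
have o1 : lift ord0 ord0 = 1 :> 'I_4 by apply/val_inj.
have o2 : lift ord0 (lift ord0 ord0) = 2 :> 'I_4 by apply/val_inj.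
have o3 : lift ord0 (lift ord0 (lift ord0 ord0)) = 3 :> 'I_4 by apply/val_inj.
rewrite /inner !mxE !big_ord_recl !big_ord0 !mxE !big_ord_recl !big_ord0 !mxE.
by rewrite /= ?o1 ?o2 ?o3; ring.
Qed.

Lemma g4_frame_orthonormal lam i j : 0 < lam ->
  inner (S3 lam) (g4_frame lam i) (g4_frame lam j)
  = if i == j then g4_sign i else 0.
Proof.
move=> l0.
have l2 : lam * (Num.sqrt lam)^-1 * (Num.sqrt lam)^-1 = 1.
  by rewrite -mulrA -invfM -expr2 sqr_sqrtr ?ltW // divff ?gt_eqF.
have s2 : (Num.sqrt 2)^-1 * (Num.sqrt 2)^-1 = 2^-1 :> R.
  by rewrite -invfM -expr2 sqr_sqrtr ?ler0n.
have s22 : 2^-1 + 2^-1 = 1 :> R by field.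
rewrite inner_S3 /g4_frame /g4_sign.
by case: i => -[|[|[|[|//]]]] /= ?; case: j => -[|[|[|[|//]]]] /= ?;
  rewrite !mxE -!val_eqE /=
    !(mulr0, mul0r, mulr1, mul1r, addr0, add0r, subr0, sub0r, oppr0,
      mulrN, mulNr, mulrN1, opprK) ?s2 ?s22 ?l2 ?subrr ?addNr
    -?opprD ?s22.
Qed.

Lemma g4_frame_unit lam : 0 < lam -> (\matrix_k g4_frame lam k) \in unitmx.
Proof.
move=> l0; set V := \matrix_k _; pose d : 'M[R]_4 := diag_mx (\row_k g4_sign k).
suff : V *m (S3 lam *m V^T *m d) = 1%:M by case/mulmx1_unit.
have VSV : V *m S3 lam *m V^T = d.
  apply/matrixP => i j; rewrite [RHS]mxE.
  transitivity (inner (S3 lam) (g4_frame lam i) (g4_frame lam j)).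
    rewrite /inner !mxE; apply: eq_bigr => k _; rewrite !mxE; congr (_ * _).
    by apply: eq_bigr => m _; rewrite !mxE.
  by rewrite g4_frame_orthonormal // mxE; case: (i == j).
rewrite !mulmxA VSV mul_diag_mx; apply/matrixP => i j; rewrite !mxE.
case: (i == j); rewrite ?mulr0 ?mulr1n //=.
by case: i => -[|[|[|[|//]]]] /= ?; rewrite /g4_sign /= ?mulr1 ?mulrNN ?mulr1.
Qed.

Lemma g4_JE lam k : 0 < lam ->
  g4_J lam (g4_frame lam k) = g4_sign k *: g4_frame lam k.
Proof. by move=> l0; apply: diag_mapE; apply: g4_frame_unit. Qed.

End G4.

(* Main.v *)
(** The symmetrised Ricci operator sends e_4 to -(lam/8) e_2, whereas every
derivation D sends e_4 = [e_1, e_3] into the derived algebra span(e_3, e_4).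
So the e_2-coordinate of c e_4 + D e_4 vanishes for all c and D, while that of
the Ricci operator at e_4 does not. *)
Require Import Defs.
From mathcomp Require Import all_boot all_order all_algebra.
From mathcomp Require Import reals.
From mathcomp Require Import ring.
Import Order.TTheory GRing.Theory Num.Theory.
Local Open Scope ring_scope.

Section G4Ricci.
Variables (R : realType) (lam : R).
Hypothesis lam_gt0 : 0 < lam.
Local Notation g4 := 'rV[R]_4.
Local Notation e k := (delta_mx 0 (k : 'I_4) : g4).
(* Curvatures are computed on explicit rows: unfolding nested connections
   coordinate by coordinate makes the terms blow up. *)
Local Notation row4 a b c d := (\row_j [:: a; b; c; d]`_(j : 'I_4) : g4).
Local Notation br := (@g4_bracket R).

Lemma row4P (x y : g4) : x 0 0 = y 0 0 -> x 0 1 = y 0 1 ->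
  x 0 2 = y 0 2 -> x 0 3 = y 0 3 -> x = y.
Proof.
move=> h0 h1 h2 h3; apply/rowP => -[[|[|[|[|//]]]] lt_j].
- by rewrite (_ : Ordinal lt_j = 0) //; apply/val_inj.
- by rewrite (_ : Ordinal lt_j = 1) //; apply/val_inj.
- by rewrite (_ : Ordinal lt_j = 2) //; apply/val_inj.
- by rewrite (_ : Ordinal lt_j = 3) //; apply/val_inj.
Qed.

Lemma row4K (x : g4) : x = row4 (x 0 0) (x 0 1) (x 0 2) (x 0 3).
Proof. by apply: row4P; rewrite !mxE. Qed.

Lemma scale_row4 k a b c d :
  k *: row4 a b c d = row4 (k * a) (k * b) (k * c) (k * d).
Proof. by apply: row4P; rewrite !mxE. Qed.

(** The -1 eigenline of [J] is spanned by e_1 - e_3, while e_2, e_4 and e_1 + e_3 are fixed, so [J]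
    exchanges e_1 and e_3. *)
Lemma g4_J_swap (x : g4) :
  g4_J lam x = row4 (x 0 2) (x 0 1) (x 0 0) (x 0 3).
Proof.
have J_lin : linear (g4_J lam) := diag_map_linear _ _.
have JZ c y : g4_J lam (c *: y) = c *: g4_J lam y.
  have J0 : g4_J lam 0 = 0 by rewrite /g4_J /diag_map !mul0mx.
  by have := J_lin c y 0; rewrite !addr0 J0 addr0.
have JD y z : g4_J lam (y + z) = g4_J lam y + g4_J lam z.
  by have := J_lin 1 y z; rewrite !scale1r.
(* Eigenvectors matter only up to scale, which removes the square roots of the frame. *)
have eigen c (k : 'I_4) y : c != 0 -> g4_frame lam k = c *: y ->
    g4_J lam y = g4_sign R k *: y.
  move=> c0 fk; apply: (scalerI c0).
  by rewrite -JZ -fk g4_JE // fk scalerA mulrC -scalerA.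
have r2 : (Num.sqrt 2 : R)^-1 != 0 by rewrite invr_eq0 sqrtr_eq0 -ltNge.
have rl : (Num.sqrt lam)^-1 != 0 by rewrite invr_eq0 sqrtr_eq0 -ltNge.
have J1 : g4_J lam (e 1) = 1 *: e 1.
  by apply: (eigen 1 0); rewrite ?oner_eq0 // scale1r.
have J3 : g4_J lam (e 3) = 1 *: e 3 by exact: (eigen _ 1 _ rl).
have Jp : g4_J lam (e 0 + e 2) = 1 *: (e 0 + e 2) by exact: (eigen _ 2 _ r2).
have Jm : g4_J lam (e 0 - e 2) = -1 *: (e 0 - e 2) by exact: (eigen _ 3 _ r2).
have -> : x = x 0 1 *: e 1 + (x 0 3 *: e 3 +
    (((x 0 0 + x 0 2) / 2) *: (e 0 + e 2) +
     ((x 0 0 - x 0 2) / 2) *: (e 0 - e 2))).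
  by apply: row4P; rewrite !mxE /=; field.
rewrite !JD !JZ J1 J3 Jp Jm.
by apply: row4P; rewrite !mxE /=; field.
Qed.

(** The inner product is nondegenerate, so it suffices to check the Koszul formula against every
    [w]. *)
Lemma g4_levi_civita (x y : g4) : levi_civita br (S3 lam) x y =
  row4 (- (lam * (x 0 0 * y 0 3 + y 0 0 * x 0 3)) / 2)
       (- (x 0 0 * y 0 0))
       (x 0 0 * y 0 1 + lam * (x 0 2 * y 0 3 + y 0 2 * x 0 3) / 2)
       ((x 0 0 * y 0 2 - x 0 2 * y 0 0) / 2).
Proof.
apply: (inner_inj (S3_unit lam_gt0)) => w.
have two0 : (2 : R) != 0 by rewrite pnatr_eq0.
apply: (mulfI two0).
rewrite (koszul (S3_unit lam_gt0) (@g4_bracket_linearl R)).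
by rewrite !inner_S3 !mxE /=; field.
Qed.

Local Notation nabla0 := (canonical_connection br (S3 lam) (g4_J lam)).
Local Notation R0 := (curvature0 br (S3 lam) (g4_J lam)).
Local Notation Ric := (Ric0 br (S3 lam) (g4_frame lam) (g4_J lam)).

(** Since [nabla0] is the average of the Levi-Civita connection and its conjugate by [J], it is
    metric and commutes with [J]. Hence it kills e_1 - e_3 and takes values fixed by [J], which
    explains the sums [y 0 0 + y 0 2] and the repeated [p]. *)
Lemma g4_canonical_connection (x y : g4) : nabla0 x y =
  let p := x 0 0 * y 0 1 / 2 - lam * (x 0 0 - x 0 2) * y 0 3 / 4 in
  row4 p (- (x 0 0 * (y 0 0 + y 0 2) / 2))
       p ((x 0 0 - x 0 2) * (y 0 0 + y 0 2) / 4).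
Proof.
rewrite /canonical_connection /nabla_J !(g4_J_swap, g4_levi_civita).
by apply: row4P; rewrite !mxE /=; field.
Qed.

Lemma g4_bracket_row4 a b c d a' b' c' d' :
  br (row4 a b c d) (row4 a' b' c' d') =
  row4 0 0 (a * b' - b * a') (a * c' - c * a').
Proof. by apply: row4P; rewrite !mxE /=; ring. Qed.

Lemma nabla0_row4 a b c d a' b' c' d' :
  nabla0 (row4 a b c d) (row4 a' b' c' d') =
  row4 (a * b' / 2 - lam * (a - c) * d' / 4) (- (a * (a' + c') / 2))
       (a * b' / 2 - lam * (a - c) * d' / 4) ((a - c) * (a' + c') / 4).
Proof. by rewrite g4_canonical_connection !mxE. Qed.

(** Each frame vector enters the Ricci sum twice, so its normalising square root appears only
    squared. *)
Lemma g4_curvature0Z k (u x : g4) :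
  R0 (k *: u) x (k *: u) = k ^+ 2 *: R0 u x u.
Proof.
rewrite /curvature0 [u]row4K [x]row4K.
rewrite !(scale_row4, g4_bracket_row4, nabla0_row4).
by apply: row4P; rewrite !mxE /=; ring.
Qed.

Lemma g4_Ric0 (x : g4) : Ric x = row4 0 0 0 (- (x 0 1 / 4)).
Proof.
have lam0 : lam != 0 by rewrite gt_eqF.
have r2 : (Num.sqrt 2 : R)^-1 ^+ 2 = 2^-1 by rewrite exprVn sqr_sqrtr ?ler0n.
have rl : (Num.sqrt lam)^-1 ^+ 2 = lam^-1 by rewrite exprVn sqr_sqrtr ?ltW.
rewrite /Ric0 !big_ord_recl big_ord0 !g4_frame_orthonormal // !eqxx.
rewrite /g4_sign /g4_frame /= !g4_curvature0Z r2 rl.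
have -> : e 1 = row4 0 1 0 0 by apply: row4P; rewrite !mxE.
have -> : e 3 = row4 0 0 0 1 by apply: row4P; rewrite !mxE.
have -> : e 0 + e 2 = row4 1 0 1 0.
  by apply: row4P; rewrite !mxE /= ?addr0 ?add0r.
have -> : e 0 - e 2 = row4 1 0 (-1) 0.
  by apply: row4P; rewrite !mxE /= ?subr0 ?sub0r.
rewrite /curvature0 [x in LHS]row4K !(g4_bracket_row4, nabla0_row4).
by apply: row4P; rewrite !mxE /=; field.
Qed.

(** [Ric] kills e_4 and sends e_2 to -(1/4) e_4, so only [rho0] at (e_2, e_4), equal to -lam/4,
    contributes; symmetrising halves it. *)
Lemma g4_sym_rho0_e4_e2 :
  sym_rho0 br (S3 lam) (g4_frame lam) (g4_J lam) (e 3) (e 1) = - (lam / 8).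
Proof. by rewrite /sym_rho0 /rho0 !g4_Ric0 !inner_S3 !mxE /=; field. Qed.

End G4Ricci.

Lemma g4_derivation_e4_e2 (R : realType) (D : 'rV[R]_4 -> 'rV[R]_4) :
  derivation (@g4_bracket R) D -> D (delta_mx 0 3) 0 1 = 0.
Proof.
move=> D_der.
have <- : g4_bracket (delta_mx 0 0) (delta_mx 0 2) = delta_mx 0 3 :> 'rV[R]_4.
  by rewrite g4_bracket_basis.
rewrite -D_der.
by rewrite !mxE /=; ring.
Qed.

Theorem theorem3p12 (R : realType) (lam : R) (lam_gt0 : 0 < lam) :
  ~ second_kind_Ricci_soliton0 (@g4_bracket R) (S3 lam) (g4_frame lam)
      (g4_J lam).
Proof.
case=> c [D [/g4_derivation_e4_e2 De4 RicE]].
have := g4_sym_rho0_e4_e2 _ _ lam_gt0.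
have J_lin : linear (g4_J lam) := diag_map_linear _ _.
rewrite -(inner_sym_Ric0 _ (S3_unit lam_gt0) (@g4_bracket_linearl R)
            (@g4_bracket_linearr R) J_lin) RicE.
(* Pairing with e_2, a unit vector orthogonal to the other e_i, reads off the e_2-coordinate; what
   remains is 0 = -(lam/8). *)
rewrite inner_S3 !mxE De4 /= !(mulr0, mul0r, mulr1, addr0) => /eqP.
by rewrite eq_sym oppr_eq0 mulf_eq0 invr_eq0 pnatr_eq0 orbF gt_eqF.
Qed.
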